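(* Let $F$ be a field of characteristic $\neq 2,3$, and let $\mathfrak{A}$ be a commutative (not necessarily associative) algebra over $F$ satisfying the identity $x^4=0$, i.e. $x(x(xx))=0$ for all $x\in\mathfrak{A}$. Let $P$ be the free commutative nonassociative polynomial ring in two generators $x$ and $y$ over $F$. Then every monomial in $P$ of $x$-degree $\geq 10$ and $y$-degree $1$ is an identity in $\mathfrak{A}$. In particular, $L_a^{10}=0$ for all $a\in\mathfrak{A}$.
   Context: All algebras are commutative but not necessarily associative (and not assumed finite-dimensional or unital). Principal powers are defined by $a^1=a$ and $a^{i+1}=a\,a^i$ for $i\ge 1$. For $a\in\mathfrak{A}$, $L_a:\mathfrak{A}\to\mathfrak{A}$ denotes the linear multiplication operator $L_a(z)=az$, and $L_a^{k}$ is its $k$-fold composition. A monomial in $P$ is a nonassociative (commutative) product, in any bracketing, of copies of the generators $x$ and $y$; its $x$-degree (resp. $y$-degree) is the number of occurrences of $x$ (resp. $y$). A polynomial $p(x,y)\in P$ is an identity in $\mathfrak{A}$ if $p(a,b)=0$ for all $a,b\in\mathfrak{A}$. *)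

(* Defs.v *)
From HB Require Import structures.
From mathcomp Require Import all_boot all_order all_algebra.
From mathcomp Require Import finmap.
From mathcomp Require Import monalg.

Set Implicit Arguments.
Unset Strict Implicit.
Unset Printing Implicit Defensive.

Import GRing.Theory.
Local Open Scope ring_scope.

(* Commutative, not necessarily associative, not necessarily unital algebras
   over F. Symmetry makes the left-hand laws sufficient for bilinearity. *)
HB.mixin Record isCommNonassocAlg (F : fieldType) A of GRing.Lmodule F A := {
  namul : A -> A -> A;
  namulC : commutative namul;
  namulDl : left_distributive namul +%R;
  nascalerAl : forall (c : F) (a b : A), c *: namul a b = namul (c *: a) b
}.

#[short(type="commNonassocAlgType")]
HB.structure Definition CommNonassocAlg (F : fieldType) :=
  { A of GRing.Lmodule F A & isCommNonassocAlg F A }.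

Notation "a ** b" := (namul a b) (at level 40, left associativity) : ring_scope.

Section AlgebraTheory.
Context (F : fieldType) (A : commNonassocAlgType F).
Implicit Types (a b c : A).

Lemma namulDr : right_distributive (@namul F A) +%R.
Proof. by move=> a b c; rewrite namulC namulDl !(namulC a). Qed.

Lemma nascalerAr (k : F) a b : k *: (a ** b) = a ** (k *: b).
Proof. by rewrite namulC nascalerAl namulC. Qed.

Lemma namul0r b : (0 : A) ** b = 0.
Proof. by rewrite -[X in X ** b](scale0r (0 : A)) -nascalerAl scale0r. Qed.

Lemma namulr0 b : b ** (0 : A) = 0.
Proof. by rewrite namulC namul0r. Qed.

Lemma namul_suml (I : Type) (r : seq I) (f : I -> A) b :
  (\sum_(i <- r) f i) ** b = \sum_(i <- r) f i ** b.
Proof.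
exact: (big_morph (fun a => a ** b) (fun a c => namulDl a c b) (namul0r b)).
Qed.

Lemma namul_sumr (I : Type) (r : seq I) (f : I -> A) b :
  b ** (\sum_(i <- r) f i) = \sum_(i <- r) b ** f i.
Proof. exact: (big_morph (namul b) (namulDr b) (namulr0 b)). Qed.

(* a^1 = a and a^{i+1} = a a^i; the value at exponent 0 is a junk value, as A
   need not have a unit. *)
Definition ppow a (n : nat) : A := iter n.-1 (namul a) a.

Lemma ppow1 a : ppow a 1 = a. Proof. by []. Qed.
Lemma ppowS a n : (0 < n)%N -> ppow a n.+1 = a ** ppow a n.
Proof. by case: n. Qed.

Definition lmulop a : A -> A := fun z => a ** z.

End AlgebraTheory.

(* The free commutative magma on two generators. Bracketed words are binary
   trees; swapping the factors at any node is quotiented out by keeping only the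
   trees whose factors are ordered, at every node, by an arbitrary fixed total
   order (that of the codes given by choice.pickle). *)
Inductive bword := BX | BY | BMul of bword & bword.

Fixpoint bword_encode (w : bword) : GenTree.tree bool :=
  match w with
  | BX => GenTree.Leaf true
  | BY => GenTree.Leaf false
  | BMul u v => GenTree.Node 0 [:: bword_encode u; bword_encode v]
  end.

Fixpoint bword_decode (t : GenTree.tree bool) : bword :=
  match t with
  | GenTree.Leaf true => BX
  | GenTree.Node _ [:: t1; t2] => BMul (bword_decode t1) (bword_decode t2)
  | _ => BY
  end.

Lemma bword_encodeK : cancel bword_encode bword_decode.
Proof. by elim=> //= u -> v ->. Qed.

HB.instance Definition _ := Countable.copy bword (can_type bword_encodeK).

Definition bword_le (u v : bword) : bool := (choice.pickle u <= choice.pickle v)%N.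

Fixpoint bword_sorted (w : bword) : bool :=
  if w is BMul u v then [&& bword_le u v, bword_sorted u & bword_sorted v]
  else true.

Record cword := CWord { cword_val : bword; _ : bword_sorted cword_val }.

HB.instance Definition _ := [isSub for cword_val].
HB.instance Definition _ := [Countable of cword by <:].

Definition cwX : cword := Sub BX isT.
Definition cwY : cword := Sub BY isT.

Definition bmul_sort (u v : bword) : bword :=
  if bword_le u v then BMul u v else BMul v u.

Lemma bmul_sort_sorted (u v : cword) : bword_sorted (bmul_sort (val u) (val v)).
Proof.
rewrite /bmul_sort; case: ifPn => [le_uv|] /=; first by rewrite le_uv !valP.
by rewrite /bword_le -ltnNge => /ltnW ->; rewrite !valP.
Qed.

Definition cwmul (u v : cword) : cword := Sub _ (bmul_sort_sorted u v).

Lemma cwmulC : commutative cwmul.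
Proof.
move=> u v; apply: val_inj; rewrite /= /bmul_sort /bword_le.
case: (ltngtP (choice.pickle (val u)) (choice.pickle (val v))) => // eq_uv.
by have -> : val u = val v by apply: (pcan_inj choice.pickleK).
Qed.

(* The free commutative nonassociative polynomial ring in x and y over F: the
   F-vector space on the free commutative magma, with the bilinear extension of
   its product. *)
Definition cnapoly (F : fieldType) := {malg F[cword]}.

HB.instance Definition _ (F : fieldType) := GRing.Lmodule.on (cnapoly F).

Section Npoly.
Context (F : fieldType).
Implicit Types (p q r : cnapoly F) (u v w : cword).

Definition cnapoly_mul p q : cnapoly F :=
  \sum_(u <- msupp p) \sum_(v <- msupp q) << p@_u * q@_v *g cwmul u v >>.

Lemma cnapoly_mulw (d1 d2 : {fset cword}) p q :
  (msupp p `<=` d1)%fset -> (msupp q `<=` d2)%fset ->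
  cnapoly_mul p q =
    \sum_(u <- d1) \sum_(v <- d2) << p@_u * q@_v *g cwmul u v >>.
Proof.
move=> le1 le2; rewrite /cnapoly_mul (big_fset_incl _ le1) /=.
  apply/eq_bigr=> u _; apply/big_fset_incl => // v _ /mcoeff_outdom ->.
  by rewrite mulr0 monalgU0.
move=> u _ /mcoeff_outdom pu.
by rewrite big1 // => v _; rewrite pu mul0r monalgU0.
Qed.

Lemma cnapoly_mulC : commutative cnapoly_mul.
Proof.
move=> p q; rewrite /cnapoly_mul exchange_big /=; apply/eq_bigr=> v _.
by apply/eq_bigr=> u _; rewrite mulrC cwmulC.
Qed.

Lemma cnapoly_mulDl : left_distributive cnapoly_mul +%R.
Proof.
move=> p q r; rewrite [in RHS](cnapoly_mulw (fsubsetUl _ (msupp q)) (fsubset_refl _)).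
rewrite [in RHS](cnapoly_mulw (fsubsetUr (msupp p) _) (fsubset_refl _)).
rewrite (cnapoly_mulw (msuppD_le _ _) (fsubset_refl _)).
rewrite -big_split /=; apply/eq_bigr=> u _.
rewrite -big_split /=; apply/eq_bigr=> v _.
by rewrite mcoeffD mulrDl monalgUD.
Qed.

Lemma cnapoly_scaleU (c d : F) u :
  c *: << d *g u >> = << c * d *g u >> :> {malg F[cword]}.
Proof.
apply/malgP=> k; rewrite mcoeffZ.
rewrite (mcoeffU u d k) (mcoeffU u (c * d) k).
by rewrite mulrnAr.
Qed.

Lemma cnapoly_scaleAl (c : F) p q : c *: cnapoly_mul p q = cnapoly_mul (c *: p) q.
Proof.
rewrite (cnapoly_mulw (msuppZ_le c p) (fsubset_refl _)) /cnapoly_mul scaler_sumr.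
apply/eq_bigr=> u _; rewrite scaler_sumr; apply/eq_bigr=> v _.
by rewrite cnapoly_scaleU mcoeffZ mulrA.
Qed.

HB.instance Definition _ :=
  isCommNonassocAlg.Build F (cnapoly F) cnapoly_mulC cnapoly_mulDl cnapoly_scaleAl.

Lemma cnapoly_mulE p q :
  p ** q = \sum_(u <- msupp p) \sum_(v <- msupp q)
             << p@_u * q@_v *g cwmul u v >>.
Proof. by []. Qed.

Definition cnaX : cnapoly F := << cwX >>.
Definition cnaY : cnapoly F := << cwY >>.

Lemma cnapoly_mulUU (c d : F) u v :
  (<< c *g u >> : cnapoly F) ** << d *g v >> = << c * d *g cwmul u v >>.
Proof.
by rewrite [LHS](cnapoly_mulw msuppU_le msuppU_le) !big_seq_fset1 !mcoeffUU.
Qed.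

(* [is_monomial i j p]: p is a product, in some bracketing, of i copies of x and
   j copies of y. *)
Inductive is_monomial : nat -> nat -> cnapoly F -> Prop :=
| is_monomialX : is_monomial 1 0 cnaX
| is_monomialY : is_monomial 0 1 cnaY
| is_monomialM i j k l p q :
    is_monomial i j p -> is_monomial k l q ->
    is_monomial (i + k) (j + l) (p ** q).

End Npoly.

Section Evaluation.
Context (F : fieldType) (A : commNonassocAlgType F) (a b : A).
Implicit Types (p q : cnapoly F) (u v w : cword).

Fixpoint bword_eval (w : bword) : A :=
  match w with
  | BX => a
  | BY => b
  | BMul u v => bword_eval u ** bword_eval v
  end.

(* p(a, b) *)
Definition cnaeval p : A := \sum_(w <- msupp p) p@_w *: bword_eval (val w).

(* cnaeval is the unique algebra morphism sending x to a and y to b, which is the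
   universal property of the free commutative algebra on x and y. *)

Lemma cnaevalEw (d : {fset cword}) p : (msupp p `<=` d)%fset ->
  cnaeval p = \sum_(w <- d) p@_w *: bword_eval (val w).
Proof.
move=> le; rewrite /cnaeval (big_fset_incl _ le) //= => w _ /mcoeff_outdom ->.
by rewrite scale0r.
Qed.

Lemma cnaeval_is_linear : linear cnaeval.
Proof.
move=> c p q.
have le1 : (msupp (c *: p + q) `<=` msupp p `|` msupp q)%fset.
  apply: fsubset_trans (msuppD_le _ _) _.
  exact: fsetSU (msuppZ_le c p).
rewrite (cnaevalEw le1) (cnaevalEw (fsubsetUl (msupp p) (msupp q))).
rewrite (cnaevalEw (fsubsetUr (msupp p) (msupp q))) scaler_sumr -big_split /=.
by apply/eq_bigr=> w _; rewrite mcoeffD mcoeffZ scalerDl scalerA.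
Qed.

HB.instance Definition _ :=
  GRing.isLinear.Build F (cnapoly F) A *:%R cnaeval cnaeval_is_linear.

Lemma cnaevalU (c : F) w : cnaeval << c *g w >> = c *: bword_eval (val w).
Proof. by rewrite (cnaevalEw msuppU_le) big_seq_fset1 mcoeffUU. Qed.

Lemma cnaevalX : cnaeval (cnaX F) = a.
Proof. by rewrite cnaevalU scale1r. Qed.

Lemma cnaevalY : cnaeval (cnaY F) = b.
Proof. by rewrite cnaevalU scale1r. Qed.

Lemma bword_eval_mul u v :
  bword_eval (val (cwmul u v)) = bword_eval (val u) ** bword_eval (val v).
Proof. by rewrite /= /bmul_sort; case: ifP => //= _; rewrite namulC. Qed.

Lemma cnaevalM p q : cnaeval (p ** q) = cnaeval p ** cnaeval q.
Proof.
rewrite cnapoly_mulE linear_sum namul_suml; apply/eq_bigr=> u _.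
rewrite linear_sum namul_sumr; apply/eq_bigr=> v _.
by rewrite [LHS]cnaevalU bword_eval_mul -nascalerAl -nascalerAr scalerA.
Qed.

Lemma cnaeval_unique (f : {linear cnapoly F -> A}) :
  f (cnaX F) = a -> f (cnaY F) = b ->
  (forall p q, f (p ** q) = f p ** f q) -> f =1 cnaeval.
Proof.
move=> fX fY fM p.
suff fU w : f << w >> = bword_eval (val w).
  rewrite [p in LHS]monalgE linear_sum; apply/eq_bigr=> w _.
  by rewrite -[X in << X *g _ >>]mulr1 -cnapoly_scaleU linearZ fU.
case: w => w; elim: w => [|| u IHu v IHv] sw.
- by rewrite (_ : CWord _ = cwX) //; apply: val_inj.
- by rewrite (_ : CWord _ = cwY) //; apply: val_inj.
have /and3P[le_uv su sv] := sw.
have -> : CWord sw = cwmul (CWord su) (CWord sv).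
  by apply: val_inj; rewrite /= /bmul_sort le_uv.
by rewrite -[1 in LHS]mulr1 -cnapoly_mulUU fM IHu IHv bword_eval_mul.
Qed.

End Evaluation.

Definition is_identity (F : fieldType) (A : commNonassocAlgType F)
    (p : cnapoly F) : Prop :=
  forall a b : A, cnaeval a b p = 0.

(* Main.v *)
(* Full polarization of x^4 = 0, possible as 2 and 3 are invertible, gives
     a K(b,c,d) + b K(a,c,d) + c K(a,b,d) + d K(a,b,c) = 0,
   where K(a,b,c) = a(bc) + b(ac) + c(ab). Read as an operator acting on d, this
   expresses the multiplication by K(a,b,c) through shorter operators. Hence
   all nonzero monomials in x are multiples of x, x^2, x^3, e4 = x^2 x^2,
   e5 = x e4 and e6 = x e5, and all their multiplication operators are
   noncommutative integer polynomials in L_x and L_{x^2}. Give these two letters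
   the weights 1 and 2: a monomial of x-degree n and y-degree 1 is a combination
   of words of weight n applied to y. The identity for the five triples
   (x,x,x^3), (x,x,e4), (x,x^2,x^3), (x,x^2,e4) and (x,x^3,x^3) gives relations
   of weights 5, 6, 6, 7 and 7 among words, and the two-sided ideal that they
   generate contains all the words of weight 10 over Z[1/6]. This last fact is a
   finite computation: integer Gaussian elimination, weight by weight, ends in a
   triangular system whose pivots divide powers of 6. *)

Require Import Defs.
From Stdlib Require Import ZArith.
From HB Require Import structures.
From mathcomp Require Import all_boot all_order all_algebra.
From mathcomp Require Import ssrZ zify.

Set Implicit Arguments.
Unset Strict Implicit.
Unset Printing Implicit Defensive.

Import GRing.Theory.
Local Open Scope ring_scope.

(** * Noncommutative integer polynomials in two letters *)

(* [NCNode c p0 p1] stands for c + L_x p0 + L_{x^2} p1. A word is a [bitseq],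
   [false] being the letter L_x and [true] the letter L_{x^2}. *)
Inductive ncpoly := NCZero | NCNode of Z & ncpoly & ncpoly.

(** Collapsing zero nodes makes the zero polynomial syntactically [NCZero], which lets [sweep]
    recognize and drop zero rows. *)
Definition nccons c p0 p1 :=
  match c, p0, p1 with
  | Z0, NCZero, NCZero => NCZero
  | _, _, _ => NCNode c p0 p1
  end.

Arguments nccons : simpl never.

Fixpoint ncadd p q :=
  match p, q with
  | NCZero, _ => q
  | _, NCZero => p
  | NCNode c p0 p1, NCNode d q0 q1 =>
      nccons (Z.add c d) (ncadd p0 q0) (ncadd p1 q1)
  end.

Fixpoint ncscale a p :=
  if p is NCNode c p0 p1 then nccons (Z.mul a c) (ncscale a p0) (ncscale a p1)
  else NCZero.

Fixpoint ncmul p q :=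
  if p is NCNode c p0 p1 then
    ncadd (ncscale c q) (nccons Z0 (ncmul p0 q) (ncmul p1 q))
  else NCZero.

Fixpoint nccoef p (w : bitseq) :=
  match p, w with
  | NCZero, _ => Z0
  | NCNode c _ _, [::] => c
  | NCNode _ p0 p1, b :: w' => nccoef (if b then p1 else p0) w'
  end.

Fixpoint ncsupp p : seq bitseq :=
  if p is NCNode c p0 p1 then
    (if c is Z0 then [::] else [:: [::]]) ++
    map (cons false) (ncsupp p0) ++ map (cons true) (ncsupp p1)
  else [::].

Fixpoint ncword (w : bitseq) :=
  match w with
  | [::] => NCNode 1 NCZero NCZero
  | true :: w' => NCNode Z0 NCZero (ncword w')
  | false :: w' => NCNode Z0 (ncword w') NCZero
  end.

Fixpoint weight (w : bitseq) : nat :=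
  if w is b :: w' then (b.+1 + weight w')%N else 0%N.

(** Words starting with L_{x^2} come first, hence are eliminated first; [triangular_ideal9_sq]
    depends on this order. *)
Fixpoint words n : seq bitseq :=
  if n is n1.+1 then
    (if n1 is n2.+1 then map (cons true) (words n2) else [::]) ++
    map (cons false) (words n1)
  else [:: [::]].

(* Euclid's algorithm on the coefficients of [w] in [p] and [q], carried out on
   the whole rows, so as to stay over the integers; [fuel] only makes the
   recursion structural. *)
Fixpoint euclid fuel w p q :=
  if fuel is fuel'.+1 then
    if Z.eqb (nccoef q w) Z0 then (p, q) else
    euclid fuel' w q
      (ncadd p (ncscale (Z.opp (Z.div (nccoef p w) (nccoef q w))) q))
  else (p, q).

Fixpoint sweep fuel w p rows :=
  if rows is q :: rows' then
    let: (p', q') := euclid fuel w p q in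
    let: (p'', rows'') := sweep fuel w p' rows' in
    (p'', if q' is NCZero then rows'' else q' :: rows'')
  else (p, [::]).

(** One pivot row is kept per word, even a zero one, so that rows and words stay aligned for
    [triangular]. *)
Fixpoint echelon fuel ws rows :=
  if ws is w :: ws' then
    let: (p, rows') := sweep fuel w NCZero rows in p :: echelon fuel ws' rows'
  else [::].

(* The part of weight [n] of a two-sided ideal, from its parts [rows1] and
   [rows2] of weights n - 1 and n - 2. The order of the rows only serves to keep
   the coefficients small. *)
Definition ideal_step fuel rels n rows1 rows2 :=
  echelon fuel (words n) (rels ++
    [seq ncmul (ncword [:: false]) q | q <- rows1] ++
    [seq ncmul q (ncword [:: true]) | q <- rows2] ++
    [seq ncmul q (ncword [:: false]) | q <- rows1] ++
    [seq ncmul (ncword [:: true]) q | q <- rows2]).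

(* Such a [c] is invertible in characteristic different from 2 and 3; the
   exponent 40 is generous. *)
Definition unit6 c := Z.eqb (Z.modulo ((6 : Z) ^+ 40) c) Z0.

(* [S] holds of words already known to vanish. *)
Fixpoint triangular (S : pred bitseq) ws rows :=
  match ws, rows with
  | w :: ws', q :: rows' =>
    [&& unit6 (nccoef q w), w \in ncsupp q, uniq (ncsupp q),
        all (fun u => [|| u == w, S u | u \in ws']) (ncsupp q)
      & triangular S ws' rows']
  | [::], _ => true
  | _, _ => false
  end.

(* The operator of multiplication by K(a,b,c), where [p], [q], [r], [pq], [pr]
   and [qr] are those of a, b, c, ab, ac and bc. *)
Definition cubic_poly p q r pq pr qr :=
  ncscale (-1 : Z)
    (ncadd (ncadd (ncmul p (ncadd (ncadd (ncmul q r) (ncmul r q)) qr))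
                  (ncmul q (ncadd (ncadd (ncmul p r) (ncmul r p)) pr)))
           (ncmul r (ncadd (ncadd (ncmul p q) (ncmul q p)) pq))).

(* [op3], [op4], [op5] and [op6] are the operators of multiplication by x^3, e4,
   e5 and e6; they come from K(x,x,x) = 3 x^3, K(x,x,x^2) = e4,
   K(x,x^2,x^2) = - e5 and K(x^2,x^2,x^2) = 3 e6. *)
Definition op1 := ncword [:: false].
Definition op2 := ncword [:: true].
Definition op3 := ncscale (-1 : Z)
  (ncmul op1 (ncadd (ncscale (2 : Z) (ncmul op1 op1)) op2)).
Definition op4 := cubic_poly op1 op1 op2 op2 op3 op3.
Definition op5 := ncscale (-1 : Z) (cubic_poly op1 op2 op2 op3 op3 op4).
Definition op6 := ncscale (-1 : Z)
  (ncmul op2 (ncadd (ncscale (2 : Z) (ncmul op2 op2)) op4)).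

(* These come from K(x,x,x^3) = - e5, K(x,x,e4) = 3 e6 and
   K(x,x^2,x^3) = K(x,x^2,e4) = K(x,x^3,x^3) = 0. *)
Definition rel113 := ncadd (cubic_poly op1 op1 op3 op2 NCZero NCZero) op5.
Definition rel114 :=
  ncadd (cubic_poly op1 op1 op4 op2 op5 op5) (ncscale (-3 : Z) op6).
Definition rel123 := cubic_poly op1 op2 op3 op3 NCZero (ncscale (-1 : Z) op5).
Definition rel124 := cubic_poly op1 op2 op4 op3 op5 op6.
Definition rel133 := cubic_poly op1 op3 op3 NCZero NCZero op6.

Definition ideal5 := ideal_step 1000 [:: rel113] 5 [::] [::].
Definition ideal6 := ideal_step 1000 [:: rel114; rel123] 6 ideal5 [::].
Definition ideal7 := ideal_step 1000 [:: rel124; rel133] 7 ideal6 ideal5.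
Definition ideal8 := ideal_step 1000 [::] 8 ideal7 ideal6.
Definition ideal9 := ideal_step 1000 [::] 9 ideal8 ideal7.
Definition ideal10 := ideal_step 1000 [::] 10 ideal9 ideal8.

Lemma triangular_ideal10 : triangular pred0 (words 10) ideal10.
Proof. by vm_compute. Qed.

(* Modulo [ideal9] a word of weight 9 that starts with L_{x^2} reduces to words
   that start with L_x, so a word of weight 11 that starts and ends with L_{x^2}
   reduces to words with a factor of weight 10. *)
Lemma triangular_ideal9_sq :
  triangular (fun w => (weight w == 11%N) && (~~ head true w || ~~ last true w))
    [seq true :: rcons w true | w <- words 7]
    [seq ncmul q (ncword [:: true]) | q <- ideal9].
Proof. by vm_compute. Qed.

Lemma mem_words w : w \in words (weight w).
Proof.
elim: w => [|[] w IHw] /=; first by rewrite inE.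
  by rewrite mem_cat map_f.
by rewrite mem_cat orbC map_f.
Qed.

(** * Polarization *)

Lemma natr_prime_neq0 (F : fieldType) p :
  prime p -> p \notin [pchar F] -> p%:R != 0 :> F.
Proof. by move=> p_pr; rewrite inE p_pr. Qed.

Lemma mulrn_inj0 (F : fieldType) (V : lmodType F) n (v : V) :
  n%:R != 0 :> F -> v *+ n = 0 -> v = 0.
Proof.
by move=> /negPf n0 /eqP; rewrite -scaler_nat scaler_eq0 n0 => /eqP.
Qed.

Lemma sym_biadditive_eq0 (F : fieldType) (V W : lmodType F) (B : V -> V -> W) :
  2%:R != 0 :> F ->
  (forall u v w, B (u + v) w = B u w + B v w) -> (forall u v, B u v = B v u) ->
  (forall v, B v v = 0) -> forall u v, B u v = 0.
Proof.
move=> char2 BD BC B0 u v; apply: (mulrn_inj0 char2).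
by have := B0 (u + v); rewrite BD !(BC _ (u + v)) !BD !B0 add0r addr0 (BC v).
Qed.

Section Quartic.
Context (F : fieldType) (V W : lmodType F).
Context (char2 : 2%:R != 0 :> F) (char3 : 3%:R != 0 :> F).
Context (Q : V -> V -> V -> V -> W).
Context (QD : forall u v b c d, Q (u + v) b c d = Q u b c d + Q v b c d).
Context (Q12 : forall a b c d, Q a b c d = Q b a c d).
Context (Q23 : forall a b c d, Q a b c d = Q a c b d).
Context (Q34 : forall a b c d, Q a b c d = Q a b d c).
Context (Q0 : forall a, Q a a a a = 0).

Let QN u b c d : Q (- u) b c d = - Q u b c d.
Proof.
have Q00 : Q 0 b c d = 0.
  by apply: (addIr (Q 0 b c d)); rewrite -QD !add0r.
by apply: (addIr (Q u b c d)); rewrite -QD !addNr.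
Qed.

Let Qswap a b c d : Q a b c d = Q c d a b.
Proof. by rewrite Q23 Q12 Q34 Q23. Qed.

Let QsumI u v c d : Q (u + v) (u - v) c d = Q u u c d - Q v v c d.
Proof.
rewrite QD !(Q12 _ (u - v)) !QD !QN (Q12 v u) addrA addrNK //.
Qed.

Let Qparallelogram u v c d :
  Q (u + v) (u + v) c d + Q (u - v) (u - v) c d = (Q u u c d + Q v v c d) *+ 2.
Proof.
rewrite !QD !QN !(Q12 _ (u + v)) !(Q12 _ (u - v)) !QD !QN (Q12 v u).
set x := Q u u c d; set y := Q u v c d; set z := Q v v c d.
rewrite mulr2n opprD opprK addrACA [x + y + _]addrACA subrr addr0.
by rewrite [y + z + _]addrACA subrr add0r addrACA.
Qed.

(* With s = u + v and d = u - v, the symmetric tensor (ss)(dd) evaluates to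
   4 (uu)(vv) by the parallelogram law, and to - 2 (uu)(vv) through
   sd = uu - vv. *)
Lemma sym_quartic_eq0_diag u v : Q u u v v = 0.
Proof.
set s := u + v; set d := u - v.
have ssdd4 : Q s s d d *+ 2 = Q u u v v *+ 8.
  have := Qparallelogram u v d d; rewrite -/s -/d Q0 addr0 => e1.
  have := Qparallelogram u v s s; rewrite -/s -/d Q0 add0r Qswap => e2.
  rewrite mulr2n {1}e1 e2 -mulrnDl addrACA.
  rewrite (Qswap u u d d) (Qswap u u s s) (Qswap v v d d) (Qswap v v s s).
  rewrite ![Q d d _ _ + _]addrC !Qparallelogram !Q0 add0r addr0.
  by rewrite (Qswap v v) -mulrnDl -mulr2n -!mulrnA.
have ssdd2 : Q s s d d = - (Q u u v v *+ 2).
  rewrite Q23 QsumI (Qswap u u) (Qswap v v) !QsumI !Q0 sub0r subr0 (Qswap v v).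
  by rewrite -opprD -mulr2n.
(* The two evaluations of (ss)(dd) differ by 12 (uu)(vv), and 12 = 2 * 2 * 3. *)
apply: (mulrn_inj0 char2); apply: (mulrn_inj0 char2); apply: (mulrn_inj0 char3).
move: ssdd4; rewrite ssdd2 mulNrn -!mulrnA => /eqP.
by rewrite eq_sym -addr_eq0 -mulrnDr => /eqP.
Qed.

(** The diagonal case is polarized twice, once in each pair of arguments. *)
Lemma sym_quartic_eq0 a b c d : Q a b c d = 0.
Proof.
have eq0l u v w : Q u v w w = 0.
  move: u v; apply: (sym_biadditive_eq0 char2) => [u1 u2 v|u v|u].
  - exact: QD.
  - exact: Q12.
  - exact: sym_quartic_eq0_diag.
move: c d; apply: (sym_biadditive_eq0 char2) => [c1 c2 d|c d|c].
- by rewrite !(Qswap a b) QD.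
- exact: Q34.
- exact: eq0l.
Qed.

End Quartic.

(** * Linearized forms of x^4 = 0 *)

Section NilIndexFour.
Context (F : fieldType) (A : commNonassocAlgType F).
Context (char2 : 2%:R != 0 :> F) (char3 : 3%:R != 0 :> F).
Context (nil4 : forall x : A, ppow x 4 = 0).
Implicit Types a b c d x z : A.

Definition cubic a b c := a ** (b ** c) + b ** (a ** c) + c ** (a ** b).

Lemma cubic12 a b c : cubic a b c = cubic b a c.
Proof. by rewrite /cubic (addrC (a ** _)) (namulC a b). Qed.

Lemma cubic23 a b c : cubic a b c = cubic a c b.
Proof. by rewrite /cubic addrAC (namulC b c). Qed.

Lemma cubicD a1 a2 b c : cubic (a1 + a2) b c = cubic a1 b c + cubic a2 b c.
Proof.
by rewrite /cubic !namulDl !namulDr [RHS]addrACA [in RHS](addrACA (a1 ** _)).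
Qed.

Definition quartic a b c d :=
  a ** cubic b c d + b ** cubic a c d + (c ** cubic a b d + d ** cubic a b c).

Lemma quartic_eq0 a b c d : quartic a b c d = 0.
Proof.
apply: (@sym_quartic_eq0 F A A char2 char3 quartic) => {a b c d}.
- move=> u v b c d; rewrite /quartic namulDl !cubicD !namulDr.
  by rewrite [RHS]addrACA; congr (_ + _); rewrite addrACA.
- by move=> a b c d; rewrite /quartic (addrC (a ** _)) !(cubic12 a b).
- move=> a b c d; rewrite /quartic (cubic12 b c) (cubic23 a b c) -!addrA.
  by congr (_ + _); rewrite addrCA.
- move=> a b c d.
  by rewrite /quartic (addrC (c ** _)) (cubic23 b c) (cubic23 a c).
- move=> a; have a4 : a ** (a ** (a ** a)) = 0 by exact: nil4.
  by rewrite /quartic /cubic !namulDr a4 !addr0.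
Qed.


Lemma namulrMn a b n : a ** (b *+ n) = (a ** b) *+ n.
Proof. by rewrite -!(scaler_nat n) -nascalerAr. Qed.

Lemma namulrN a b : a ** (- b) = - (a ** b).
Proof. by rewrite -!scaleN1r -nascalerAr. Qed.

Lemma cubic_diag a : cubic a a a = (a ** (a ** a)) *+ 3.
Proof. by rewrite /cubic !mulrS addr0 addrA. Qed.

(** Repeated arguments produce a common factor, 3 here and 2 in the next lemma, which is
    cancelled. *)
Lemma quartic_aaad a d : a ** cubic a a d + d ** (a ** (a ** a)) = 0.
Proof.
apply: (mulrn_inj0 char3); rewrite mulrnDl -(namulrMn d) -cubic_diag.
have := quartic_eq0 a a a d.
by rewrite /quartic !mulrS addr0 !addrA.
Qed.

Lemma quartic_aabb a b : a ** cubic a b b + b ** cubic a a b = 0.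
Proof.
apply: (mulrn_inj0 char2); rewrite mulrnDl !mulr2n.
exact: (quartic_eq0 a a b b).
Qed.

Lemma quartic_aabc a b c :
  (a ** cubic a b c) *+ 2 + (b ** cubic a a c + c ** cubic a a b) = 0.
Proof. by rewrite mulr2n; exact: (quartic_eq0 a a b c). Qed.

Definition zscalar (c : Z) : F := (int_of_Z c)%:~R.

Lemma zscalarD (c d : Z) : zscalar (Z.add c d) = zscalar c + zscalar d.
Proof. by rewrite /zscalar -[Z.add c d]/(c + d) !rmorphD. Qed.

Lemma zscalarM (c d : Z) : zscalar (Z.mul c d) = zscalar c * zscalar d.
Proof. by rewrite /zscalar -[Z.mul c d]/(c * d) !rmorphM. Qed.

(** The image of c divides that of 6^40, which is nonzero in F. *)
Lemma unit6_neq0 (c : Z) : unit6 c -> zscalar c != 0.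
Proof.
move=> /Z.eqb_spec c0.
have := Z_div_mod_eq_full ((6 : Z) ^+ 40) c; rewrite c0 Z.add_0_r.
have zscalar6 n : zscalar ((6 : Z) ^+ n) = 6%:R ^+ n.
  by elim: n => // n IHn; rewrite !exprS zscalarM IHn.
move/(congr1 zscalar); rewrite zscalarM zscalar6; apply: contra_eq_neq => ->.
by rewrite mul0r expf_neq0 // (natrM _ 2 3) mulf_neq0.
Qed.

(** * Evaluation of polynomials as operators *)

Section Evaluation.
Context (x : A).

Fixpoint nceval p z : A :=
  if p is NCNode c p0 p1 then
    zscalar c *: z + (x ** nceval p0 z + (x ** x) ** nceval p1 z)
  else 0.

Fixpoint wact (w : bitseq) z : A :=
  if w is b :: w' then (if b then x ** x else x) ** wact w' z else z.

Lemma wact_rcons (w : bitseq) (b : bool) z :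
  wact (rcons w b) z = wact w ((if b then x ** x else x) ** z).
Proof. by elim: w => //= c w ->. Qed.

Lemma wact0 w : wact w 0 = 0.
Proof. by elim: w => //= b w ->; rewrite namulr0. Qed.

Lemma wactZD w (c : F) u v : wact w (c *: u + v) = c *: wact w u + wact w v.
Proof. by elim: w => //= b w ->; rewrite namulDr nascalerAr. Qed.

Lemma nceval_cons (c : Z) p0 p1 z :
  nceval (nccons c p0 p1) z = nceval (NCNode c p0 p1) z.
Proof.
case: c => // ; case: p0 => //; case: p1 => //=.
by rewrite /zscalar scale0r !namulr0 !addr0.
Qed.

Lemma nceval_add p q z : nceval (ncadd p q) z = nceval p z + nceval q z.
Proof.
elim: p q => [|c p0 IHp0 p1 IHp1] [|d q0 q1]; rewrite ?(add0r, addr0) //.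
rewrite [ncadd _ _]/= nceval_cons /= zscalarD IHp0 IHp1 scalerDl !namulDr.
by rewrite [RHS]addrACA; congr (_ + _); rewrite addrACA.
Qed.

Lemma nceval_scale (a : Z) p z :
  nceval (ncscale a p) z = zscalar a *: nceval p z.
Proof.
elim: p => [|c p0 IHp0 p1 IHp1]; first by rewrite scaler0.
rewrite [ncscale _ _]/= nceval_cons /= zscalarM IHp0 IHp1.
by rewrite !scalerDr scalerA -!nascalerAr.
Qed.

Lemma nceval_mul p q z : nceval (ncmul p q) z = nceval p (nceval q z).
Proof.
elim: p => [|c p0 IHp0 p1 IHp1] //.
by rewrite [ncmul _ _]/= nceval_add nceval_scale nceval_cons /= IHp0 IHp1
           /zscalar scale0r add0r.
Qed.

Lemma nceval0 p : nceval p 0 = 0.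
Proof. by elim: p => //= c p0 -> p1 ->; rewrite scaler0 !namulr0 !addr0. Qed.

Lemma nceval_word w z : nceval (ncword w) z = wact w z.
Proof.
elim: w => [|[] w IHw] /=; rewrite ?IHw namulr0 ?scale0r ?(add0r, addr0) //.
by rewrite namulr0 addr0 /zscalar rmorph1 scale1r.
Qed.

Lemma nceval_supp p z :
  nceval p z = \sum_(w <- ncsupp p) zscalar (nccoef p w) *: wact w z.
Proof.
elim: p => [|c p0 IHp0 p1 IHp1] /=; first by rewrite big_nil.
rewrite !big_cat !big_map /= {}IHp0 {}IHp1 !namul_sumr; congr (_ + (_ + _)).
- by case: c => [|c|c]; rewrite ?big_seq1 // big_nil scale0r.
- by apply: eq_bigr => w _; rewrite nascalerAr.
- by apply: eq_bigr => w _; rewrite nascalerAr.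
Qed.

(** * Soundness of the elimination *)

Definition vanish p := forall z, nceval p z = 0.

Lemma vanish_add p q : vanish p -> vanish q -> vanish (ncadd p q).
Proof. by move=> p0 q0 z; rewrite nceval_add p0 q0 addr0. Qed.

Lemma vanish_scale (a : Z) p : vanish p -> vanish (ncscale a p).
Proof. by move=> p0 z; rewrite nceval_scale p0 scaler0. Qed.

Lemma vanish_mull p q : vanish q -> vanish (ncmul p q).
Proof. by move=> q0 z; rewrite nceval_mul q0 nceval0. Qed.

Lemma vanish_mulr p q : vanish p -> vanish (ncmul p q).
Proof. by move=> p0 z; rewrite nceval_mul p0. Qed.

Fixpoint vanishing rows :=
  if rows is q :: rows' then vanish q /\ vanishing rows' else True.

Lemma vanishing_cat rows1 rows2 :
  vanishing rows1 -> vanishing rows2 -> vanishing (rows1 ++ rows2).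
Proof. by elim: rows1 => //= q rows1 IH [q0 /IH v1] /v1. Qed.

Lemma vanishing_map f rows :
  (forall q, vanish q -> vanish (f q)) -> vanishing rows ->
  vanishing (map f rows).
Proof. by move=> vf; elim: rows => //= q rows IH [/vf ? /IH]. Qed.

(** Only row operations occur, so the fuel is irrelevant to soundness; the shape of the result is
    checked separately by [triangular]. *)
Lemma euclid_vanish fuel w p q : vanish p -> vanish q ->
  vanish (euclid fuel w p q).1 /\ vanish (euclid fuel w p q).2.
Proof.
elim: fuel p q => [|fuel IH] p q p0 q0 //=.
case: Z.eqb => //; apply: IH => //; apply: vanish_add => //.
exact: vanish_scale.
Qed.

Lemma sweep_vanish fuel w p rows : vanish p -> vanishing rows ->
  vanish (sweep fuel w p rows).1 /\ vanishing (sweep fuel w p rows).2.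
Proof.
elim: rows p => //= q rows IH p p0 [q0 rows0].
have := euclid_vanish fuel w p0 q0; case: euclid => p' q' /= [p'0 q'0].
have := IH p' p'0 rows0; case: sweep => p'' rows' /= [].
by case: q' q'0.
Qed.

Lemma echelon_vanish fuel ws rows :
  vanishing rows -> vanishing (echelon fuel ws rows).
Proof.
elim: ws rows => //= w ws IH rows rows0.
have := @sweep_vanish fuel w NCZero rows (fun=> erefl) rows0.
by case: sweep => p rows' /= [? /IH].
Qed.

Lemma ideal_step_vanish fuel rels n rows1 rows2 :
  vanishing rels -> vanishing rows1 -> vanishing rows2 ->
  vanishing (ideal_step fuel rels n rows1 rows2).
Proof.
move=> rels0 rows10 rows20; apply: echelon_vanish.
apply: vanishing_cat => //; do !apply: vanishing_cat;
  apply: vanishing_map => // q; by [exact: vanish_mull | exact: vanish_mulr].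
Qed.

(** Back substitution: a row equates an invertible multiple of its pivot word with a combination of
    words already known to vanish. *)
Lemma triangular_vanish (S : pred bitseq) ws rows :
  (forall w, S w -> forall z, wact w z = 0) -> vanishing rows ->
  triangular S ws rows -> forall w, w \in ws -> forall z, wact w z = 0.
Proof.
move=> S0; elim: ws rows => // w ws IH [|q rows] //= [q0 rows0].
case/and5P=> cw w_supp supp_uniq /allP supp_le tri u.
have ws0 := IH rows rows0 tri.
rewrite inE => /orP[/eqP-> z|/ws0 //].
have := q0 z; rewrite nceval_supp (bigD1_seq w) //= big_seq_cond big1 => [|v].
  by rewrite addr0 => /eqP; rewrite scaler_eq0 (negPf (unit6_neq0 cw)) => /eqP.
case/andP=> /supp_le /or3P[/eqP->|Sv|v_ws] vw; first by rewrite eqxx in vw.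
  by rewrite S0 // scaler0.
by rewrite ws0 // scaler0.
Qed.

(** * The subalgebra generated by x *)

Let e2 := x ** x.
Let e3 := x ** e2.
Let e4 := e2 ** e2.
Let e5 := x ** e4.
Let e6 := x ** e5.

Lemma mul13 : x ** e3 = 0.
Proof. exact: nil4. Qed.

Lemma cubic112 : cubic x x e2 = e4.
Proof. by rewrite /cubic -/e3 -/e2 mul13 !add0r. Qed.

Lemma mul23 : e2 ** e3 = - e5.
Proof.
by apply/eqP; rewrite -addr_eq0 addrC -[e5]/(x ** e4) -cubic112 quartic_aaad.
Qed.

Lemma cubic113 : cubic x x e3 = - e5.
Proof. by rewrite /cubic mul13 !namulr0 !add0r namulC mul23. Qed.

Lemma mul33 : e3 ** e3 = e6.
Proof.
apply/eqP; rewrite -subr_eq0 addrC -[e6]/(x ** e5) -namulrN -cubic113.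
by apply/eqP/quartic_aaad.
Qed.

Lemma cubic122 : cubic x e2 e2 = - e5.
Proof. by rewrite /cubic -/e4 -/e5 -/e3 mul23 addrN add0r. Qed.

Lemma mul24 : e2 ** e4 = e6.
Proof.
apply/eqP; rewrite -subr_eq0 addrC -[e6]/(x ** e5) -namulrN -cubic122 -cubic112.
by apply/eqP/quartic_aabb.
Qed.

Lemma cubic114 : cubic x x e4 = e6 *+ 3.
Proof. by rewrite /cubic -/e5 -/e6 namulC -/e2 mul24 !mulrS addr0 addrA. Qed.

Lemma cubic123 : cubic x e2 e3 = 0.
Proof.
by rewrite /cubic mul23 mul13 namulr0 addr0 namulrN -/e6 -/e3 mul33 addNr.
Qed.

Lemma cubic222 : cubic e2 e2 e2 = e6 *+ 3.
Proof. by rewrite cubic_diag -/e4 mul24. Qed.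

Lemma mul25_mul34 : e2 ** e5 = e3 ** e4.
Proof.
have := quartic_aabc x e2 e3; rewrite cubic123 cubic113 cubic112 namulr0 mul0rn.
by rewrite add0r namulrN addrC => /eqP; rewrite subr_eq0 => /eqP.
Qed.

Lemma mul25_mul16 : e2 ** e5 = x ** e6.
Proof.
have := quartic_aaad e2 x; rewrite -/e4 mul24 cubic23 cubic12 cubic122 namulrN.
by rewrite addrC => /eqP; rewrite subr_eq0 => /eqP.
Qed.

(** The identity at (x,x,x,e4) reads 3 x e6 + e3 e4 = 0; since e3 e4 = e2 e5 = x e6, this is 4 x e6
    = 0. *)
Lemma mul16 : x ** e6 = 0.
Proof.
have := quartic_aaad x e4; rewrite cubic114 namulrMn -/e2 -/e3 namulC.
rewrite (namulC e4) -mul25_mul34 mul25_mul16 (namulC e6) -mulrSr => x4.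
by apply: (mulrn_inj0 char2); apply: (mulrn_inj0 char2); rewrite -mulrnA.
Qed.

Lemma mul25 : e2 ** e5 = 0.
Proof. by rewrite mul25_mul16 mul16. Qed.

Lemma mul34 : e3 ** e4 = 0.
Proof. by rewrite -mul25_mul34 mul25. Qed.

Lemma mul26 : e2 ** e6 = 0.
Proof. by rewrite -mul24; exact: nil4. Qed.

(** * The relations between operators *)

Definition represents p a := forall z, nceval p z = a ** z.

Lemma represents_add p q a b :
  represents p a -> represents q b -> represents (ncadd p q) (a + b).
Proof. by move=> pa qb z; rewrite nceval_add pa qb namulDl. Qed.

Lemma represents_scale (c : Z) p a :
  represents p a -> represents (ncscale c p) (zscalar c *: a).
Proof. by move=> pa z; rewrite nceval_scale pa nascalerAl. Qed.

Lemma represents_opp p a :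
  represents p a -> represents (ncscale (-1 : Z) p) (- a).
Proof.
by move=> pa; rewrite -scaleN1r; exact: (represents_scale (-1 : Z) pa).
Qed.

(** Keeps coefficients integral when K yields a triple: the quotient by 3 is verified by multiplying
    back. *)
Lemma represents_div3 p q a :
  ncscale (3 : Z) p = q -> represents q (a *+ 3) -> represents p a.
Proof.
move=> <- qa z; apply/eqP; rewrite -subr_eq0; apply/eqP/(mulrn_inj0 char3).
rewrite mulrnBl (namulC a) -namulrMn (namulC z) -qa nceval_scale.
by rewrite -[zscalar _]/(3%:R : F) scaler_nat subrr.
Qed.

Lemma represents0 p : represents p 0 -> vanish p.
Proof. by move=> p0 z; rewrite p0 namul0r. Qed.

Lemma represents_cubic p q r pq pr qr a b c :
  represents p a -> represents q b -> represents r c ->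
  represents pq (a ** b) -> represents pr (a ** c) -> represents qr (b ** c) ->
  represents (cubic_poly p q r pq pr qr) (cubic a b c).
Proof.
move=> pa qb rc pqab prac qrbc z.
rewrite /cubic_poly nceval_scale !(nceval_add, nceval_mul).
rewrite !(pa, qb, rc, pqab, prac, qrbc) -[zscalar _]/(-1) scaleN1r.
rewrite !(namulC (_ ** _) z) (namulC (cubic _ _ _)).
have := quartic_eq0 a b c z; rewrite /quartic addrA => /eqP.
by rewrite addr_eq0 => /eqP Qabc; rewrite -[RHS]opprK -Qabc.
Qed.

Lemma represents_op0 : represents NCZero 0.
Proof. by move=> z; rewrite namul0r. Qed.

Lemma represents_op1 : represents op1 x.
Proof. exact: (nceval_word [:: false]). Qed.

Lemma represents_op2 : represents op2 e2.
Proof. exact: (nceval_word [:: true]). Qed.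

Lemma represents_op3 : represents op3 e3.
Proof.
apply: (represents_div3 (q := cubic_poly op1 op1 op1 op2 op2 op2)) => //.
rewrite -cubic_diag; apply: represents_cubic;
  by [exact: represents_op1 | exact: represents_op2].
Qed.

Lemma represents_op4 : represents op4 e4.
Proof.
rewrite -cubic112; apply: represents_cubic;
  by [exact: represents_op1 | exact: represents_op2 | exact: represents_op3].
Qed.

Lemma represents_op5 : represents op5 e5.
Proof.
rewrite -[e5]opprK -cubic122; apply/represents_opp/represents_cubic;
  by [exact: represents_op1 | exact: represents_op2 | exact: represents_op3
     | exact: represents_op4].
Qed.

Lemma represents_op6 : represents op6 e6.
Proof.
apply: (represents_div3 (q := cubic_poly op2 op2 op2 op4 op4 op4)) => //.
rewrite -cubic222; apply: represents_cubic;
  by [exact: represents_op2 | exact: represents_op4].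
Qed.

(** Here and below, an element that is zero in the subalgebra is given a nontrivial operator
    polynomial, which must then vanish. *)
Lemma vanish_rel113 : vanish rel113.
Proof.
apply: represents0; rewrite -(addNr e5) -cubic113.
apply: represents_add represents_op5.
by apply: represents_cubic;
  rewrite ?mul13; [exact: represents_op1 | exact: represents_op1
  | exact: represents_op3 | exact: represents_op2 | exact: represents_op0..].
Qed.

Lemma vanish_rel114 : vanish rel114.
Proof.
apply: represents0.
have <- : cubic x x e4 + zscalar (-3 : Z) *: e6 = 0.
  by rewrite cubic114 -scaler_nat -[zscalar _]/(- 3%:R) scaleNr subrr.
apply: represents_add; last exact: represents_scale represents_op6.
by apply: represents_cubic; [exact: represents_op1 | exact: represents_op1
  | exact: represents_op4 | exact: represents_op2 | exact: represents_op5..].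
Qed.

Lemma vanish_rel123 : vanish rel123.
Proof.
apply: represents0; rewrite -cubic123.
by apply: represents_cubic; rewrite ?mul13 ?mul23; [exact: represents_op1
  | exact: represents_op2 | exact: represents_op3 | exact: represents_op3
  | exact: represents_op0 | exact: represents_opp represents_op5].
Qed.

Lemma vanish_rel124 : vanish rel124.
Proof.
apply: represents0; have <- : cubic x e2 e4 = 0.
  by rewrite /cubic mul24 mul16 mul25 (namulC e4) mul34 !addr0.
by apply: represents_cubic; rewrite ?mul24; [exact: represents_op1
  | exact: represents_op2 | exact: represents_op4 | exact: represents_op3
  | exact: represents_op5 | exact: represents_op6].
Qed.

Lemma vanish_rel133 : vanish rel133.
Proof.
apply: represents0; have <- : cubic x e3 e3 = 0.
  by rewrite /cubic mul33 mul16 mul13 namulr0 !addr0.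
by apply: represents_cubic; rewrite ?mul13 ?mul33; [exact: represents_op1
  | exact: represents_op3 | exact: represents_op3 | exact: represents_op0
  | exact: represents_op0 | exact: represents_op6].
Qed.

(** * Vanishing of the words of weight at least 10 *)

Lemma vanishing_ideals : vanishing ideal9 /\ vanishing ideal10.
Proof.
have v5 : vanishing ideal5.
  exact: (@ideal_step_vanish _ [:: rel113] _ [::] [::]
            (conj vanish_rel113 I) I I).
have v6 : vanishing ideal6.
  exact: (@ideal_step_vanish _ [:: rel114; rel123] _ _ [::]
            (conj vanish_rel114 (conj vanish_rel123 I)) v5 I).
have v7 : vanishing ideal7.
  exact: (@ideal_step_vanish _ [:: rel124; rel133] _ _ _
            (conj vanish_rel124 (conj vanish_rel133 I)) v6 v5).
have v8 : vanishing ideal8 by exact: (@ideal_step_vanish _ [::] _ _ _ I v7 v6).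
have v9 : vanishing ideal9 by exact: (@ideal_step_vanish _ [::] _ _ _ I v8 v7).
exact (conj v9 (@ideal_step_vanish _ [::] _ _ _ I v9 v8)).
Qed.

Lemma wact10_eq0 w z : weight w = 10%N -> wact w z = 0.
Proof.
move=> w10.
have w_in : w \in words 10 by rewrite -w10 mem_words.
have S0 u : pred0 u -> forall y, wact u y = 0 by [].
exact (triangular_vanish S0 (proj2 vanishing_ideals) triangular_ideal10 w_in z).
Qed.

Lemma weight_rcons (w : bitseq) (b : bool) :
  weight (rcons w b) = (weight w + b.+1)%N.
Proof. by elim: w => [|c w IHw] /=; rewrite ?addn0 // IHw addnA. Qed.

(** A first or last letter L_x can be split off, leaving weight 10; the other words are handled by
    [triangular_ideal9_sq]. *)
Lemma wact11_eq0 w z : weight w = 11%N -> wact w z = 0.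
Proof.
pose S u := (weight u == 11%N) && (~~ head true u || ~~ last true u).
have S0 u : S u -> forall y, wact u y = 0.
  case/andP=> /eqP + /orP; case: (lastP u) => [|{}u b] // + [] + y.
    case: u => [|[] u] //=; case: b => // -[u10] _;
      by rewrite -/(wact _ y) wact10_eq0 ?namulr0.
  rewrite last_rcons weight_rcons; case: b => //; rewrite addn1 => -[u10] _.
  by rewrite wact_rcons wact10_eq0.
move=> w11; case/boolP: (S w) => [Sw|]; first exact: S0.
rewrite /S w11 eqxx negb_or !negbK => /andP[w_head w_last].
have [u u7 wE] : exists2 u, weight u = 7%N & w = true :: rcons u true.
  case: w w11 w_head w_last => [|[] w] //=.
  case: (lastP w) => // {}w b; rewrite last_rcons weight_rcons.
  by case: b => // w11 _ _; exists w => //; lia.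
have w_in : w \in [seq true :: rcons u true | u <- words 7].
  rewrite wE -u7; apply: (map_f (fun u => true :: rcons u true)).
  exact: mem_words.
have v9 q : vanish q -> vanish (ncmul q op2) by exact: vanish_mulr.
exact (triangular_vanish S0 (vanishing_map v9 (proj1 vanishing_ideals))
         triangular_ideal9_sq w_in z).
Qed.

(** Letters weigh at most 2, so the shortest suffix of weight at least 10 has weight 10 or 11. *)
Lemma wact_eq0 w z : (10 <= weight w)%N -> wact w z = 0.
Proof.
elim: w => //= b w IHw; case: (leqP 10 (weight w)) => [/IHw-> _|w9 w10].
  exact: namulr0.
have : weight (b :: w) = 10%N \/ weight (b :: w) = 11%N.
  by case: b w10 => /= w10; [lia|lia].
by case; [exact: wact10_eq0 | exact: wact11_eq0].
Qed.

(** * Monomials *)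

(** Serves both for y-degree 1, with b the value of y, and for monomials in x alone, with b = x; in
    the latter case n is the degree minus one. *)
Inductive wspan b : nat -> A -> Prop :=
| wspan_id : wspan b 0 b
| wspan0 n : wspan b n 0
| wspanZD n (c : F) u v : wspan b n u -> wspan b n v -> wspan b n (c *: u + v)
| wspan1 n v : wspan b n v -> wspan b n.+1 (x ** v)
| wspan2 n v : wspan b n v -> wspan b n.+2 (e2 ** v).

Lemma wspan_eq0 b n v : wspan b n v -> (10 <= n)%N -> v = 0.
Proof.
(* Generalizing over a word w acting on v lets the induction move the letters of v into w. *)
move=> bv n10; suff act0 w : (10 <= weight w + n)%N -> wact w v = 0.
  by rewrite -[v]/(wact [::] v) act0.
elim: bv w {n10} => {n v} [|n|n c u v _ IHu _ IHv|n v _ IHv|n v _ IHv] w.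
- by rewrite addn0 => /wact_eq0->.
- by rewrite wact0.
- by move=> wn; rewrite wactZD IHu // IHv // scaler0 addr0.
- move=> wn; rewrite -(wact_rcons w false) IHv // weight_rcons.
  by rewrite -addnA.
- move=> wn; rewrite -(wact_rcons w true) IHv // weight_rcons.
  by rewrite -addnA.
Qed.

(** Indexed by x-degree: entry 0 is a placeholder, and the default 0 accounts for the vanishing in
    degrees 7 and above. *)
Definition basis n := nth 0 [:: 0; x; e2; e3; e4; e5; e6] n.

Lemma wspan_basis n v : wspan x n v -> exists c : F, v = c *: basis n.+1.
Proof.
elim=> {n v} [|n|n c u v _ [cu ->] _ [cv ->]|n v _ [c ->]|n v _ [c ->]].
- by exists 1; rewrite scale1r.
- by exists 0; rewrite scale0r.
- by exists (c * cu + cv); rewrite scalerDl scalerA.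
- rewrite -nascalerAr.
  suff [d ->] : exists d : F, x ** basis n.+1 = d *: basis n.+2.
    by exists (c * d); rewrite scalerA.
  case: n => [|[|[|[|[|[|n]]]]]]; rewrite /basis /=.
  + by exists 1; rewrite scale1r.
  + by exists 1; rewrite scale1r.
  + by exists 0; rewrite scale0r mul13.
  + by exists 1; rewrite scale1r.
  + by exists 1; rewrite scale1r.
  + by exists 0; rewrite scale0r mul16.
  + by exists 0; rewrite scale0r nth_nil namulr0.
- rewrite -nascalerAr.
  suff [d ->] : exists d : F, e2 ** basis n.+1 = d *: basis n.+3.
    by exists (c * d); rewrite scalerA.
  case: n => [|[|[|[|[|[|n]]]]]]; rewrite /basis /=.
  + by exists 1; rewrite scale1r namulC.
  + by exists 1; rewrite scale1r.
  + by exists (- 1); rewrite scaleN1r mul23.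
  + by exists 1; rewrite scale1r mul24.
  + by exists 0; rewrite scale0r mul25.
  + by exists 0; rewrite scale0r mul26.
  + by exists 0; rewrite scale0r nth_nil namulr0.
Qed.

Lemma wspanD b n u v : wspan b n u -> wspan b n v -> wspan b n (u + v).
Proof. by move=> bu bv; rewrite -[u]scale1r; exact: wspanZD. Qed.

Lemma wspanZ b n (c : F) v : wspan b n v -> wspan b n (c *: v).
Proof.
by move=> bv; rewrite -[_ *: _]addr0; exact: wspanZD bv (wspan0 _ _).
Qed.

Lemma wspan_wact b k v w : wspan b k v -> wspan b (weight w + k) (wact w v).
Proof.
by move=> bv; elim: w => //= -[] w IHw; [exact: wspan2 | exact: wspan1].
Qed.

Lemma wspan_nceval b k v n p :
  all (fun w => weight w == n) (ncsupp p) -> wspan b k v ->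
  wspan b (n + k) (nceval p v).
Proof.
move=> /allP pn bv; rewrite nceval_supp big_seq.
apply: big_ind => [|u1 u2|w /pn /eqP <-]; [exact: wspan0 | exact: wspanD |].
exact/wspanZ/wspan_wact.
Qed.

Lemma wspan_basis_mul b k v n :
  wspan b k v -> wspan b (n + k) (basis n ** v).
Proof.
move=> bv; have mulE p a :
    represents p a -> all (fun w => weight w == n) (ncsupp p) ->
    wspan b (n + k) (a ** v).
  by move=> pa pn; rewrite -pa; exact: wspan_nceval.
case: n mulE => [|[|[|[|[|[|[|n]]]]]]] mulE; rewrite /basis /=.
- by rewrite namul0r; exact: wspan0.
(* Homogeneity of each operator polynomial is settled by computation. *)
- exact: mulE represents_op1 _.
- exact: mulE represents_op2 _.
- exact: mulE represents_op3 _.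
- exact: mulE represents_op4 _.
- exact: mulE represents_op5 _.
- exact: mulE represents_op6 _.
- by rewrite nth_nil namul0r; exact: wspan0.
Qed.

Lemma wspan_mul b k u v n :
  wspan x n u -> wspan b k v -> wspan b (n.+1 + k) (u ** v).
Proof.
move=> /wspan_basis[c ->] bv; rewrite -nascalerAl.
exact/wspanZ/wspan_basis_mul.
Qed.

(** The two y-degrees are treated together, since in a product of y-degree 1 one factor involves x
    only. *)
Lemma monomial_wspan b i j p : is_monomial i j p ->
  (j = 0%N -> (0 < i)%N /\ wspan x i.-1 (cnaeval x b p)) /\
  (j = 1%N -> wspan b i (cnaeval x b p)).
Proof.
elim=> {i j p} [||i j k l p q _ [IHp0 IHp1] _ [IHq0 IHq1]].
- by split=> // _; rewrite cnaevalX; split=> //; exact: wspan_id.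
- by split=> // _; rewrite cnaevalY; exact: wspan_id.
rewrite cnaevalM; split.
  case: j IHp0 {IHp1} => // /(_ erefl)[]; case: i => // i _ px.
  move=> /= l0; have [] := IHq0 l0; case: k {IHq0 IHq1} => // k _ qx.
  by split=> //; rewrite addnS -addSn; exact: wspan_mul.
case: j IHp0 IHp1 => [/(_ erefl)[+ px] _ /= l1|[_ /(_ erefl) pb|//]].
  by case: i px => // i px _; exact: wspan_mul (IHq1 l1).
case: l IHq0 {IHq1} => // /(_ erefl)[]; case: k => // k _ qx _.
by rewrite addnC namulC; exact: wspan_mul.
Qed.

End Evaluation.
End NilIndexFour.

Theorem theorem1 (F : fieldType) (A : commNonassocAlgType F)
    (char2 : 2%N \notin [pchar F]) (char3 : 3%N \notin [pchar F])
    (nil4 : forall x : A, ppow x 4 = 0) :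
  (forall (i : nat) (p : cnapoly F),
      (10 <= i)%N -> is_monomial i 1 p -> is_identity A p) /\
  (forall a z : A, iter 10 (lmulop a) z = 0).
Proof.
have two0 := natr_prime_neq0 (isT : prime 2) char2.
have three0 := natr_prime_neq0 (isT : prime 3) char3.
split=> [i p i10 /monomial_wspan p_mon a b|a z].
  have [_ /(_ erefl) ab] := p_mon A two0 three0 nil4 a b.
  exact: (wspan_eq0 two0 three0 nil4 ab).
(* The action of the word L_x^10 unfolds to the tenfold iterate. *)
exact: (wact_eq0 two0 three0 nil4 (w := nseq 10 false) a z).
Qed.
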